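(* $$\sum_{k=1}^\infty\frac{S_1(2k)-S_1(k)+\frac2k}{k^4\binom{2k}{k}}=\frac{11}{9}\zeta_5.$$
   Context: $S_1(n):=\sum_{i=1}^n \frac1i$ is the $n$-th harmonic number, and $\zeta_5:=\sum_{i=1}^\infty \frac{1}{i^5}$. *)

(* Defs.v *)
From Stdlib Require Import Reals.
From Coquelicot Require Import Coquelicot.
Open Scope R_scope.

(* [sum_n_m a 1 n] is [a 1 + ... + a n], and is 0 when [n = 0]. *)
Definition S1 (n : nat) : R := sum_n_m (fun i : nat => 1 / INR i) 1 n.

(* Series are indexed from 0, so the index is shifted by one. *)
Definition zeta5 : R := Series (fun i : nat => 1 / INR (S i) ^ 5).

(* [Binomial.C] is the real-valued binomial coefficient; unqualified, [C] is
   the type of complex numbers. *)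
Definition summand (k : nat) : R :=
  (S1 (2 * k) - S1 k + 2 / INR k) / (INR k ^ 4 * Binomial.C (2 * k) k).

(* Main.v *)
Require Import Defs.
From Stdlib Require Import Reals Factorial Lra Lia.
From Coquelicot Require Import Coquelicot.
Open Scope R_scope.

(** Let c(s,t) = s! t! / (s+t)!, which makes sense for real arguments, and write
    zeta(a,b) for the sum of k^(-a) j^(-b) over 1 <= j < k.  Since
    c(k,k) = 1 / binom(2k,k), the summand of the theorem is -1/2 times the
    derivative at x = 0 of c(k+x,k+x) / (k+x)^4.  So the theorem is the
    derivative of an evaluation of

      A = sum of c(k,k) / k^4

    that stays valid for shifted indices.  The relations
    c(j-1,k) - c(j,k) = c(j,k) k/j and c(j,k-1) - c(j,k) = c(j,k) j/k let sums
    against c telescope.  Starting from the axis j = 0, where c = 1, and ending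
    on the diagonal, one finds, with P and Q the sums of c(j,k) / (j k^3) and
    c(j,k) / (j^2 k^2) over j < k,

      zeta(4) = 2 A + P,   zeta(2,2) = A + 2 Q,   zeta(3,1) = 2 P + Q,

    and therefore 9 A = 4 zeta(4) - 2 zeta(3,1) + zeta(2,2).

    The derivatives of the three evaluations are [zeta4_derivative],
    [zeta22_derivative] and [zeta31_derivative].  The first shifts both indices
    of c.  The other two shift the second index only, which leaves c = 1 on
    the axis and so keeps the axis sums free of harmonic numbers; the
    symmetry of c, in the form of [diagonal_symmetry], makes up for the missing
    half.  With S the sum of the theorem, the outcome
    ([diagonal_evaluation]) is

      -18 S = -20 zeta(5) + 8 zeta(4,1) - 4 zeta(2,3),

    and 2 zeta(2,3) - 4 zeta(4,1) = zeta(5) ([zeta_relation]) follows from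
    Euler's sum formula and from the two ways of expanding zeta(2) zeta(3).

    All this is carried out for sums with indices up to N, so that every
    rearrangement is finite, with derivatives replaced by their explicit
    values.  Cutting the telescoping sums at N costs values of c on the outer
    edge, of size at most 1/(N+1), times powers of the harmonic number H_N; the total error
    is of order H_N^4 / N. *)

(** * Finite sums *)

Definition rsum (a b : nat) (f : nat -> R) : R := sum_n_m f a b.

Lemma rsum_empty a b f : (b < a)%nat -> rsum a b f = 0.
Proof. intros H; exact (sum_n_m_zero f a b H). Qed.

Lemma rsum_last a b f : (a <= S b)%nat -> rsum a (S b) f = rsum a b f + f (S b).
Proof. intros H; exact (sum_n_Sm f a b H). Qed.

Lemma rsum_first a b f : (a <= b)%nat -> rsum a b f = f a + rsum (S a) b f.
Proof. intros H; exact (sum_Sn_m f a b H). Qed.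

Lemma rsum_ext a b f g :
  (forall i, (a <= i <= b)%nat -> f i = g i) -> rsum a b f = rsum a b g.
Proof. exact (sum_n_m_ext_loc f g a b). Qed.

Lemma rsum_plus a b f g : rsum a b (fun i => f i + g i) = rsum a b f + rsum a b g.
Proof. exact (sum_n_m_plus f g a b). Qed.

Lemma rsum_scal a b x f : rsum a b (fun i => x * f i) = x * rsum a b f.
Proof. exact (sum_n_m_mult_l (K := R_Ring) x f a b). Qed.

Lemma rsum_lin a b x y f g :
  rsum a b (fun i => x * f i + y * g i) = x * rsum a b f + y * rsum a b g.
Proof. now rewrite rsum_plus, 2!rsum_scal. Qed.

Lemma rsum_minus a b f g : rsum a b (fun i => f i - g i) = rsum a b f - rsum a b g.
Proof.
  replace (rsum a b f - rsum a b g) with (1 * rsum a b f + (-1) * rsum a b g) by ring.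
  rewrite <- rsum_lin; apply rsum_ext; intros; ring.
Qed.

Lemma rsum_split a m b f : (a <= S m)%nat -> (m <= b)%nat ->
  rsum a b f = rsum a m f + rsum (S m) b f.
Proof. intros H1 H2; exact (sum_n_m_Chasles f a m b H1 H2). Qed.

Lemma rsum_telescope a b u : (a <= b)%nat ->
  rsum (S a) b (fun i => u (pred i) - u i) = u a - u b.
Proof.
  induction 1 as [|b Hab IH].
  - rewrite rsum_empty by lia; ring.
  - rewrite rsum_last, IH by lia; simpl; ring.
Qed.

Lemma rsum_triangle_swap N (f : nat -> nat -> R) :
  rsum 1 N (fun k => rsum 1 k (fun j => f j k)) =
  rsum 1 N (fun j => rsum j N (fun k => f j k)).
Proof.
  induction N as [|N IH].
  - now rewrite !rsum_empty by lia.
  - rewrite rsum_last, IH by lia.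
    rewrite (rsum_last 1 N (fun j => rsum j (S N) (fun k => f j k))) by lia.
    rewrite (rsum_first (S N)), (rsum_empty (S (S N))) by lia.
    rewrite (rsum_last 1 N (fun j => f j (S N))) by lia.
    rewrite Rplus_0_r, <- Rplus_assoc, <- rsum_plus; f_equal.
    apply rsum_ext; intros; now rewrite rsum_last by lia.
Qed.

Lemma rsum_shift a b m f : rsum (a + m) (b + m) f = rsum a b (fun i => f (i + m)%nat).
Proof.
  destruct (Nat.lt_ge_cases b a) as [H|H].
  - now rewrite 2!rsum_empty by lia.
  - induction H as [|b Hab IH].
    + rewrite (rsum_first a), (rsum_first (a + m)), 2!rsum_empty by lia; ring.
    + cbn [Nat.add]; rewrite 2!rsum_last by lia; now rewrite IH.
Qed.

Lemma rsum_reflect n f : rsum 1 n (fun i => f (S n - i)%nat) = rsum 1 n f.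
Proof.
  revert f; induction n as [|n IH]; intros f.
  - now rewrite 2!rsum_empty by lia.
  - rewrite rsum_first by lia.
    replace (S (S n) - 1)%nat with (S n) by lia.
    rewrite (rsum_last 1 n f) by lia.
    rewrite <- (IH f).
    change 2%nat with (1 + 1)%nat at 1.
    replace (S n) with (n + 1)%nat at 2 by lia.
    rewrite rsum_shift, Rplus_comm; f_equal.
    apply rsum_ext; intros; f_equal; lia.
Qed.

Lemma rsum_le a b f g :
  (forall i, (a <= i <= b)%nat -> f i <= g i) -> rsum a b f <= rsum a b g.
Proof.
  intros Hfg; destruct (Nat.lt_ge_cases b a) as [H|H].
  - rewrite 2!rsum_empty by lia; lra.
  - induction H as [|b Hab IH].
    + rewrite 2!(rsum_first a), 2!rsum_empty by lia;
      assert (f a <= g a) by (apply Hfg; lia); lra.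
    + rewrite 2!rsum_last by lia.
      apply Rplus_le_compat; [apply IH; intros; apply Hfg | apply Hfg]; lia.
Qed.

Lemma rsum_abs a b f : Rabs (rsum a b f) <= rsum a b (fun i => Rabs (f i)).
Proof.
  destruct (Nat.lt_ge_cases b a) as [H|H].
  - rewrite 2!rsum_empty by lia; rewrite Rabs_R0; lra.
  - induction H as [|b Hab IH].
    + rewrite 2!(rsum_first a), 2!rsum_empty by lia; rewrite 2!Rplus_0_r; lra.
    + rewrite 2!rsum_last by lia.
      eapply Rle_trans; [apply Rabs_triang|lra].
Qed.

(** * Harmonic numbers *)

Definition h (n : nat) : R := S1 n.

Lemma h_0 : h 0 = 0.
Proof. exact (rsum_empty 1 0 (fun i => 1 / INR i) (Nat.lt_0_succ 0)). Qed.

Lemma h_S n : h (S n) = h n + / INR (S n).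
Proof.
  unfold h, S1; fold (rsum 1 (S n) (fun i => 1 / INR i)).
  rewrite rsum_last by lia; unfold rsum, Rdiv; now rewrite Rmult_1_l.
Qed.

Lemma INR_index_pos n : (1 <= n)%nat -> 0 < INR n.
Proof. intros; apply lt_0_INR; lia. Qed.

Lemma h_sum n : h n = rsum 1 n (fun i => / INR i).
Proof.
  unfold h, S1, rsum; apply sum_n_m_ext_loc; intros; unfold Rdiv; apply Rmult_1_l.
Qed.

Lemma h_nonneg n : 0 <= h n.
Proof.
  induction n as [|n IH]; [rewrite h_0; lra|].
  rewrite h_S; assert (0 < / INR (S n)) by (apply Rinv_0_lt_compat, INR_index_pos; lia); lra.
Qed.

Lemma h_mono a b : (a <= b)%nat -> h a <= h b.
Proof.
  induction 1; [lra|]. rewrite h_S.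
  assert (0 < / INR (S m)) by (apply Rinv_0_lt_compat, INR_index_pos; lia); lra.
Qed.

Lemma h_ge_1 n : (1 <= n)%nat -> 1 <= h n.
Proof.
  intros H; apply Rle_trans with (h 1); [|now apply h_mono].
  rewrite h_S, h_0; simpl; lra.
Qed.

(** The sum of the reciprocals is a harmonic number; every error term below is
    estimated by spending one such reciprocal weight per summation index. *)
Lemma rsum_weight_bound a b N B f : (1 <= a)%nat -> (b <= N)%nat -> 0 <= B ->
  (forall i, (a <= i <= b)%nat -> Rabs (f i) <= B / INR i) ->
  Rabs (rsum a b f) <= B * h N.
Proof.
  intros Ha Hb HB Hf.
  eapply Rle_trans; [apply rsum_abs|].
  eapply Rle_trans; [apply rsum_le; exact Hf|].
  unfold Rdiv; rewrite rsum_scal; apply Rmult_le_compat_l; [easy|].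
  destruct (Nat.lt_ge_cases b a).
  - rewrite rsum_empty by easy; apply h_nonneg.
  - eapply Rle_trans; [|apply h_mono, Hb].
    rewrite h_sum, (rsum_split 1 (pred a) b) by lia.
    replace (S (pred a)) with a by lia.
    rewrite <- h_sum; assert (0 <= h (pred a)) by apply h_nonneg; lra.
Qed.

(** * The connector *)

(** The connector, the Beta-type weight of the method of connected sums.  On the
    diagonal it is the reciprocal of the central binomial coefficient, on the
    axes it is 1. *)
Definition conn (j k : nat) : R := INR (fact j) * INR (fact k) / INR (fact (j + k)).
(** The derivative of the connector in its second argument: the logarithmic
    derivative of [k! / (j + k)!] in [k] is [h k - h (j + k)], Euler's constant
    cancelling.  By symmetry [conn' k j] is the derivative in the first argument
    at [(j, k)]. *)
Definition conn' (j k : nat) : R := conn j k * (h k - h (j + k)).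

Lemma conn_sym j k : conn j k = conn k j.
Proof. unfold conn; rewrite (Nat.add_comm k j); field; apply INR_fact_neq_0. Qed.

Lemma conn_0_l k : conn 0 k = 1.
Proof. unfold conn; simpl; field; apply INR_fact_neq_0. Qed.

Lemma conn_0_r k : conn k 0 = 1.
Proof. rewrite conn_sym; apply conn_0_l. Qed.

Lemma conn'_0_l k : conn' 0 k = 0.
Proof. unfold conn'; simpl; ring. Qed.

Lemma conn'_0_r k : conn' k 0 = - h k.
Proof. unfold conn'; rewrite conn_0_r, h_0, Nat.add_0_r; ring. Qed.

(** This relation and [conn_step_r] are what makes sums against the connector
    telescope in both directions. *)
Lemma conn_step_l j k : (1 <= j)%nat ->
  conn (pred j) k = conn j k + conn j k * INR k / INR j.
Proof.
  intros Hj; destruct j as [|j]; [lia|]; simpl pred; unfold conn.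
  replace (S j + k)%nat with (S (j + k)) by lia.
  rewrite 2!fact_simpl, 2!mult_INR, (S_INR j), (S_INR (j + k)), plus_INR.
  assert (H1 := pos_INR j); assert (H2 := pos_INR k).
  field; repeat split; try apply INR_fact_neq_0; lra.
Qed.

Lemma conn_step_r j k : (1 <= k)%nat ->
  conn j (pred k) = conn j k + conn j k * INR j / INR k.
Proof. intros; rewrite conn_sym, conn_step_l, (conn_sym k j); auto. Qed.

(** The derivative of [conn_step_l] in [k], where the factor [k] contributes
    the extra term. *)
Lemma conn'_step_l j k : (1 <= j)%nat ->
  conn' (pred j) k = conn' j k + (conn' j k * INR k + conn j k) / INR j.
Proof.
  intros Hj; unfold conn'; rewrite conn_step_l by easy.
  destruct j as [|j]; [lia|]; simpl pred.
  replace (S j + k)%nat with (S (j + k)) by lia.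
  rewrite h_S, (S_INR j), (S_INR (j + k)), plus_INR.
  assert (H1 := pos_INR j); assert (H2 := pos_INR k).
  field; lra.
Qed.

(** The derivative of [conn_step_r] in [k], where the factor [1 / k]
    contributes the extra term. *)
Lemma conn'_step_r j k : (1 <= k)%nat ->
  conn' j (pred k) = conn' j k + conn' j k * INR j / INR k - conn j k * INR j / INR k ^ 2.
Proof.
  intros Hk; unfold conn'; rewrite conn_step_r by easy.
  destruct k as [|k]; [lia|]; simpl pred.
  replace (j + S k)%nat with (S (j + k)) by lia.
  rewrite 2!h_S, (S_INR k), (S_INR (j + k)), plus_INR.
  assert (H1 := pos_INR j); assert (H2 := pos_INR k).
  field; lra.
Qed.

Lemma conn_pos j k : 0 < conn j k.
Proof.
  unfold conn, Rdiv.
  repeat apply Rmult_lt_0_compat; try apply INR_fact_lt_0.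
  apply Rinv_0_lt_compat, INR_fact_lt_0.
Qed.

(** The connector decreases in [k], so the value at [k = 1] bounds it. *)
Lemma conn_le_inv N k : (1 <= k)%nat -> conn N k <= / INR (S N).
Proof.
  induction 1 as [|k Hk IH].
  - right; unfold conn; rewrite Nat.add_1_r, (fact_simpl N), mult_INR.
    change (fact 1) with 1%nat; rewrite INR_1; field; split.
    + apply not_0_INR; lia.
    + apply INR_fact_neq_0.
  - eapply Rle_trans; [|exact IH].
    assert (H := conn_step_r N (S k) ltac:(lia)); simpl pred in H; rewrite H.
    assert (0 <= conn N (S k) * INR N / INR (S k)); [|lra].
    apply Rmult_le_pos; [apply Rmult_le_pos|].
    + left; apply conn_pos.
    + apply pos_INR.
    + left; apply Rinv_0_lt_compat, INR_index_pos; lia.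
Qed.

Lemma h_add_le j k : h (j + k) - h k <= h j.
Proof.
  induction j as [|j IH]; simpl Nat.add.
  - rewrite h_0; lra.
  - rewrite 2!h_S.
    assert (/ INR (S (j + k)) <= / INR (S j)); [|lra].
    apply Rinv_le_contravar; [apply INR_index_pos; lia | apply le_INR; lia].
Qed.

Lemma conn'_abs j k : Rabs (conn' j k) <= conn j k * h j.
Proof.
  unfold conn'; rewrite Rabs_mult, (Rabs_pos_eq (conn j k)) by (left; apply conn_pos).
  apply Rmult_le_compat_l; [left; apply conn_pos|].
  rewrite Rabs_left1.
  - assert (H := h_add_le j k); lra.
  - assert (H := h_mono k (j + k) ltac:(lia)); lra.
Qed.

(** A common bound for the connector and its derivative on the outer edges of
    the square of indices up to [N], where the exact telescoping sums are cut. *)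
Definition edge (N : nat) : R := h N / INR (S N).

Lemma edge_nonneg N : 0 <= edge N.
Proof.
  apply Rmult_le_pos; [apply h_nonneg|].
  left; apply Rinv_0_lt_compat, INR_index_pos; lia.
Qed.

Lemma conn_edge N k : (1 <= N)%nat -> (1 <= k)%nat -> Rabs (conn N k) <= edge N.
Proof.
  intros HN Hk; rewrite Rabs_pos_eq by (left; apply conn_pos).
  eapply Rle_trans; [now apply conn_le_inv|].
  assert (H1 := h_ge_1 N HN).
  assert (0 < / INR (S N)) by (apply Rinv_0_lt_compat, INR_index_pos; lia).
  unfold edge, Rdiv; nra.
Qed.

Lemma conn'_row_edge N k : (1 <= k)%nat -> Rabs (conn' N k) <= edge N.
Proof.
  intros Hk; eapply Rle_trans; [apply conn'_abs|].
  unfold edge, Rdiv; rewrite Rmult_comm; apply Rmult_le_compat_l; [apply h_nonneg|].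
  now apply conn_le_inv.
Qed.

Lemma conn'_col_edge N j : (1 <= j <= N)%nat -> Rabs (conn' j N) <= edge N.
Proof.
  intros Hj; eapply Rle_trans; [apply conn'_abs|].
  unfold edge, Rdiv; rewrite Rmult_comm.
  apply Rmult_le_compat; [apply h_nonneg | left; apply conn_pos | apply h_mono; lia |].
  rewrite conn_sym; now apply conn_le_inv.
Qed.

(** * Sums over triangles of indices *)

Definition tri (N : nat) (f : nat -> nat -> R) : R :=
  rsum 1 N (fun k => rsum 1 (pred k) (fun j => f j k)).

Lemma rsum_triangle N f :
  rsum 1 N (fun k => rsum 1 k (fun j => f j k)) =
  tri N f + rsum 1 N (fun k => f k k).
Proof.
  unfold tri; rewrite <- rsum_plus; apply rsum_ext; intros k Hk.
  destruct k as [|k]; [lia|]; now rewrite rsum_last by lia.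
Qed.

Lemma tri_rows N f :
  tri N f = rsum 1 N (fun j => rsum (S j) N (fun k => f j k)).
Proof.
  apply Rplus_eq_reg_r with (rsum 1 N (fun k => f k k)).
  rewrite <- rsum_triangle, rsum_triangle_swap, <- rsum_plus.
  apply rsum_ext; intros j Hj; rewrite (rsum_first j) by lia; ring.
Qed.

Lemma tri_ext N f g :
  (forall j k, (1 <= j < k)%nat -> f j k = g j k) -> tri N f = tri N g.
Proof.
  intros H; apply rsum_ext; intros k Hk; apply rsum_ext; intros j Hj; apply H; lia.
Qed.

Lemma tri_lin N x y f g :
  tri N (fun j k => x * f j k + y * g j k) = x * tri N f + y * tri N g.
Proof.
  unfold tri; rewrite <- rsum_lin; apply rsum_ext; intros; apply rsum_lin.
Qed.

(** On the axis [n = 0] the connector is 1, so the left-hand side will be a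
    harmonic sum; on the diagonal it carries the central binomial coefficients. *)
Lemma rsum_to_diagonal N (F : nat -> nat -> R) :
  rsum 1 N (fun m => F 0%nat m) =
  rsum 1 N (fun m => F m m) +
  rsum 1 N (fun m => rsum 1 m (fun n => F (pred n) m - F n m)).
Proof.
  rewrite <- rsum_plus; apply rsum_ext; intros m Hm.
  rewrite (rsum_telescope 0 m (fun n => F n m)) by lia; ring.
Qed.

(** * Row and column tails *)

(** Tails over one row or one column of indices, cut at [N].  The primed
    versions are the derivatives in the second argument [m], all indices of a
    row being shifted together with [m]; this is why [row'] has a second term
    and [col'] has none. *)
Definition row (N r n m : nat) : R := rsum (S m) N (fun k => conn n k / INR k ^ r).
Definition row' (N r n m : nat) : R :=
  rsum (S m) N (fun k => conn' n k / INR k ^ r - INR r * conn n k / INR k ^ S r).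
Definition col (N r n m : nat) : R := rsum (S n) N (fun i => conn i m / INR i ^ r).
Definition col' (N r n m : nat) : R := rsum (S n) N (fun i => conn' i m / INR i ^ r).

Ltac pfield :=
  field; repeat split; try apply pow_nonzero; apply not_0_INR; lia.

(** The factor [k] of [conn_step_l] lowers the exponent by one. *)
Lemma row_step N r n m : (1 <= n)%nat ->
  row N (S r) (pred n) m - row N (S r) n m = row N r n m / INR n.
Proof.
  intros Hn; unfold row; unfold Rdiv at 3; rewrite Rmult_comm, <- rsum_scal, <- rsum_minus.
  apply rsum_ext; intros k Hk; rewrite conn_step_l by easy; simpl pow; pfield.
Qed.

Lemma row'_step N r n m : (1 <= n)%nat ->
  row' N (S r) (pred n) m - row' N (S r) n m = row' N r n m / INR n.
Proof.
  intros Hn; unfold row'; unfold Rdiv at 5; rewrite Rmult_comm, <- rsum_scal, <- rsum_minus.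
  apply rsum_ext; intros k Hk; rewrite conn_step_l, conn'_step_l by easy.
  rewrite (S_INR r); simpl pow; pfield.
Qed.

(** At exponent one the row telescopes in its own index. *)
Lemma row_1 N n m : (1 <= n)%nat -> (m <= N)%nat ->
  row N 1 n m = (conn n m - conn n N) / INR n.
Proof.
  intros Hn Hm; rewrite <- (rsum_telescope m N (fun k => conn n k)) by easy.
  unfold row, Rdiv at 2; rewrite Rmult_comm, <- rsum_scal.
  apply rsum_ext; intros k Hk; rewrite conn_step_r by lia; pfield.
Qed.

Lemma row'_1 N n m : (1 <= n)%nat -> (m <= N)%nat ->
  row' N 1 n m = (conn' n m - conn' n N) / INR n.
Proof.
  intros Hn Hm; rewrite <- (rsum_telescope m N (fun k => conn' n k)) by easy.
  unfold row', Rdiv at 3; rewrite Rmult_comm, <- rsum_scal.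
  apply rsum_ext; intros k Hk; rewrite conn'_step_r by lia; rewrite INR_1; pfield.
Qed.

Lemma row_2_step N n m : (1 <= n)%nat -> (m <= N)%nat ->
  row N 2 (pred n) m - row N 2 n m = (conn n m - conn n N) / INR n ^ 2.
Proof. intros; rewrite row_step, row_1 by easy; pfield. Qed.

Lemma row'_2_step N n m : (1 <= n)%nat -> (m <= N)%nat ->
  row' N 2 (pred n) m - row' N 2 n m = (conn' n m - conn' n N) / INR n ^ 2.
Proof. intros; rewrite row'_step, row'_1 by easy; pfield. Qed.

(** Both sides change in [n] by the same amount, so the row and the column
    differ by their values on the outer edge.  Without the cut at [N] this says
    that the double tail of zeta(2) is symmetric in [n] and [m]. *)
Lemma row_col N n m : (n <= N)%nat -> (m <= N)%nat ->
  row N 2 n m = col N 2 n m + (row N 2 N m - col N 2 n N).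
Proof.
  intros Hn Hm.
  enough (row N 2 n m - row N 2 N m = col N 2 n m - col N 2 n N) by lra.
  rewrite <- (rsum_telescope n N (fun n => row N 2 n m)) by easy.
  unfold col; rewrite <- rsum_minus; apply rsum_ext; intros i Hi.
  rewrite row_2_step by lia; pfield.
Qed.

Lemma row'_col' N n m : (n <= N)%nat -> (m <= N)%nat ->
  row' N 2 n m = col' N 2 n m + (row' N 2 N m - col' N 2 n N).
Proof.
  intros Hn Hm.
  enough (row' N 2 n m - row' N 2 N m = col' N 2 n m - col' N 2 n N) by lra.
  rewrite <- (rsum_telescope n N (fun n => row' N 2 n m)) by easy.
  unfold col'; rewrite <- rsum_minus; apply rsum_ext; intros i Hi.
  rewrite row'_2_step by lia; pfield.
Qed.

(** The factor [i] of the step relations in [m] lowers the exponent by one; the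
    second term is the derivative of [1 / m]. *)
Lemma col'_step N r n m : (1 <= m)%nat ->
  col' N (S r) n (pred m) - col' N (S r) n m =
  col' N r n m / INR m - col N r n m / INR m ^ 2.
Proof.
  intros Hm.
  replace (col' N r n m / INR m - col N r n m / INR m ^ 2)
    with (/ INR m * col' N r n m + - / INR m ^ 2 * col N r n m) by pfield.
  unfold col', col; rewrite <- rsum_lin, <- rsum_minus.
  apply rsum_ext; intros i Hi; rewrite conn'_step_r by easy; simpl pow; pfield.
Qed.

(** * Size of the tails on the outer edges *)

Lemma inv_le_1 i : (1 <= i)%nat -> 0 < / INR i <= 1.
Proof.
  intros Hi; split; [now apply Rinv_0_lt_compat, INR_index_pos|].
  rewrite <- Rinv_1; apply Rinv_le_contravar; [lra|].
  rewrite <- INR_1; now apply le_INR.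
Qed.

Lemma col_edge N n : (1 <= N)%nat -> Rabs (col N 2 n N) <= edge N * h N.
Proof.
  intros HN; apply rsum_weight_bound; [lia|lia|apply edge_nonneg|]; intros i Hi.
  assert (Hc : Rabs (conn i N) <= edge N) by (rewrite conn_sym; apply conn_edge; lia).
  assert (Hw := inv_le_1 i ltac:(lia)).
  replace (conn i N / INR i ^ 2) with (conn i N * (/ INR i * / INR i)) by pfield.
  rewrite Rabs_mult, (Rabs_pos_eq (/ INR i * / INR i)) by nra.
  assert (H := Rabs_pos (conn i N)); unfold Rdiv.
  apply Rmult_le_compat; nra.
Qed.

Lemma col'_edge N r n : (1 <= N)%nat -> (1 <= r)%nat ->
  Rabs (col' N r n N) <= edge N * h N.
Proof.
  intros HN Hr; apply rsum_weight_bound; [lia|lia|apply edge_nonneg|]; intros i Hi.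
  assert (Hc : Rabs (conn' i N) <= edge N) by (apply conn'_col_edge; lia).
  assert (Hw := inv_le_1 i ltac:(lia)).
  unfold Rdiv; rewrite Rabs_mult.
  apply Rmult_le_compat; try apply Rabs_pos; [easy|].
  assert (H1 : 1 <= INR i) by (rewrite <- INR_1; apply le_INR; lia).
  assert (H2 : INR i <= INR i ^ r).
  { rewrite <- (pow_1 (INR i)) at 1; now apply Rle_pow. }
  rewrite Rabs_pos_eq.
  - apply Rinv_le_contravar; lra.
  - left; apply Rinv_0_lt_compat; lra.
Qed.

Lemma row_edge N m : (1 <= N)%nat -> Rabs (row N 2 N m) <= edge N * h N.
Proof.
  intros HN; apply rsum_weight_bound; [lia|lia|apply edge_nonneg|]; intros i Hi.
  assert (Hc : Rabs (conn N i) <= edge N) by (apply conn_edge; lia).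
  assert (Hw := inv_le_1 i ltac:(lia)).
  replace (conn N i / INR i ^ 2) with (conn N i * (/ INR i * / INR i)) by pfield.
  rewrite Rabs_mult, (Rabs_pos_eq (/ INR i * / INR i)) by nra.
  assert (H := Rabs_pos (conn N i)); unfold Rdiv.
  apply Rmult_le_compat; nra.
Qed.

Lemma row'_edge N m : (1 <= N)%nat -> Rabs (row' N 2 N m) <= 3 * edge N * h N.
Proof.
  intros HN; assert (HB := edge_nonneg N).
  apply rsum_weight_bound; [lia|lia|lra|]; intros i Hi.
  assert (Hc : Rabs (conn N i) <= edge N) by (apply conn_edge; lia).
  assert (Hp : Rabs (conn' N i) <= edge N) by (apply conn'_row_edge; lia).
  assert (Hw := inv_le_1 i ltac:(lia)).
  replace (conn' N i / INR i ^ 2 - INR 2 * conn N i / INR i ^ 3)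
    with ((conn' N i * / INR i - 2 * conn N i * (/ INR i * / INR i)) * / INR i)
    by (simpl INR; pfield).
  rewrite Rabs_mult, (Rabs_pos_eq (/ INR i)) by lra.
  apply Rmult_le_compat_r; [lra|].
  assert (0 < / INR i * / INR i <= 1) by nra.
  set (x := / INR i) in *; set (y := x * x) in *.
  apply Rabs_le_between in Hc; apply Rabs_le_between in Hp.
  apply Rabs_le_between; split; nra.
Qed.

(** * From the axis to the diagonal *)

(** Shifting both indices of [conn n k / k^4] by the same real number and
    differentiating gives the function [F] of the proof; telescoping it in [n] from 0 to
    [k] is the derivative of zeta(4) = 2 A + P.  Nothing is cut here. *)
Lemma zeta4_derivative N :
  rsum 1 N (fun k => - h k / INR k ^ 4 - 4 / INR k ^ 5) =
  rsum 1 N (fun k => 4 * conn' k k / INR k ^ 4 - 8 * conn k k / INR k ^ 5) +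
  tri N (fun j k => (conn' j k + conn' k j) / (INR j * INR k ^ 3)
                    - 3 * conn j k / (INR j * INR k ^ 4)
                    - conn j k / (INR j ^ 2 * INR k ^ 3)).
Proof.
  set (F := fun n k => (conn' n k + conn' k n) / INR k ^ 4 - 4 * conn n k / INR k ^ 5).
  assert (HF : forall n k, (1 <= n)%nat -> (1 <= k)%nat -> F (pred n) k - F n k =
     (conn' n k + conn' k n) / (INR n * INR k ^ 3) - 3 * conn n k / (INR n * INR k ^ 4)
      - conn n k / (INR n ^ 2 * INR k ^ 3)).
  { intros n k Hn Hk; unfold F.
    rewrite conn'_step_l, conn'_step_r, conn_step_l, (conn_sym k n) by easy; pfield. }
  transitivity (rsum 1 N (fun k => F 0%nat k)).
  { apply rsum_ext; intros; unfold F; rewrite conn'_0_l, conn'_0_r, conn_0_l; pfield. }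
  rewrite rsum_to_diagonal.
  rewrite rsum_triangle, (Rplus_comm (tri _ _)), <- Rplus_assoc, <- rsum_plus; f_equal.
  - apply rsum_ext; intros k Hk; rewrite HF by lia; unfold F; pfield.
  - apply tri_ext; intros; apply HF; lia.
Qed.

Lemma rsum_rows_to_tri N r (w w' : nat -> R) n :
  rsum 1 N (fun m => w m * row' N r (n m) m + w' m * row N r (n m) m) =
  tri N (fun m k => w m * (conn' (n m) k / INR k ^ r - INR r * conn (n m) k / INR k ^ S r)
                    + w' m * (conn (n m) k / INR k ^ r)).
Proof.
  rewrite tri_rows; apply rsum_ext; intros m Hm.
  unfold row, row'; now rewrite rsum_lin.
Qed.

(** The derivative in the second index of zeta(2,2) = A + 2 Q.  The step in [n]
    of the quadratic row tail is a single connector, which moves the axis to the diagonal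
    at the cost of a second copy of the triangular sum. *)
Lemma zeta22_derivative N :
  tri N (fun j k => - 2 / (INR j ^ 2 * INR k ^ 3) - 2 / (INR j ^ 3 * INR k ^ 2)) =
  rsum 1 N (fun k => conn' k k / INR k ^ 4 - 2 * conn k k / INR k ^ 5) +
  tri N (fun j k => 2 * conn' j k / (INR j ^ 2 * INR k ^ 2)
                    - 2 * conn j k / (INR j ^ 3 * INR k ^ 2)
                    - 4 * conn j k / (INR j ^ 2 * INR k ^ 3)) -
  rsum 1 N (fun j => rsum 1 j (fun i =>
    conn' i N / (INR i ^ 2 * INR j ^ 2) - 2 * conn i N / (INR i ^ 2 * INR j ^ 3))).
Proof.
  set (F := fun n m => / INR m ^ 2 * row' N 2 n m + - 2 / INR m ^ 3 * row N 2 n m).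
  transitivity (rsum 1 N (fun m => F 0%nat m)).
  { unfold F; rewrite (rsum_rows_to_tri N 2 _ _ (fun _ => 0%nat)).
    apply tri_ext; intros j k Hjk; rewrite conn'_0_l, conn_0_l; simpl INR; pfield. }
  rewrite rsum_to_diagonal.
  unfold F at 1; rewrite (rsum_rows_to_tri N 2 _ _ (fun m => m)).
  rewrite (rsum_ext 1 N _ (fun j =>
    rsum 1 j (fun i => conn' i j / (INR i ^ 2 * INR j ^ 2) - 2 * conn i j / (INR i ^ 2 * INR j ^ 3))
    - rsum 1 j (fun i =>
      conn' i N / (INR i ^ 2 * INR j ^ 2) - 2 * conn i N / (INR i ^ 2 * INR j ^ 3)))).
  2:{ intros j Hj; rewrite <- rsum_minus; apply rsum_ext; intros i Hi; unfold F.
      transitivity (/ INR j ^ 2 * (row' N 2 (pred i) j - row' N 2 i j)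
        + - 2 / INR j ^ 3 * (row N 2 (pred i) j - row N 2 i j)); [ring|].
      rewrite row_2_step, row'_2_step by lia; pfield. }
  rewrite rsum_minus, rsum_triangle.
  match goal with |- ?a + (?b + ?d - ?e) = _ =>
    replace (a + (b + d - e)) with (d + (1 * a + 1 * b) - e) by ring end.
  rewrite <- tri_lin; f_equal; f_equal.
  - apply rsum_ext; intros; pfield.
  - apply tri_ext; intros; simpl INR; pfield.
Qed.

(** The case [n = m] of [row'_col']: on the diagonal, the derivatives of the
    double tail of zeta(2) in its two arguments agree up to edge values.  This converts derivatives in
    the second index only into derivatives along the diagonal. *)
Lemma diagonal_symmetry N :
  tri N (fun j k => (conn' j k - conn' k j) / (INR j ^ 2 * INR k ^ 2)
                    - 2 * conn j k / (INR j ^ 2 * INR k ^ 3)) =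
  rsum 1 N (fun j => (row' N 2 N j - col' N 2 j N) / INR j ^ 2).
Proof.
  rewrite tri_rows; apply rsum_ext; intros j Hj.
  assert (H := row'_col' N j j ltac:(lia) ltac:(lia)).
  replace (row' N 2 N j - col' N 2 j N) with (row' N 2 j j - col' N 2 j j) by lra.
  unfold Rdiv at 3; rewrite Rmult_comm.
  unfold row', col'; rewrite <- rsum_minus, <- rsum_scal.
  apply rsum_ext; intros; simpl INR; pfield.
Qed.

(** The derivative in the second index of zeta(3,1) = 2 P + Q.  Telescoping the cubic
    row tail towards the diagonal leaves quadratic row tails; replaced by
    column tails, these telescope in the other direction. *)
Lemma zeta31_derivative N :
  tri N (fun j k => - 3 / (INR j * INR k ^ 4) - 1 / (INR j ^ 2 * INR k ^ 3)) =
  tri N (fun j k => (conn' j k + conn' k j) / (INR j * INR k ^ 3)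
                    - conn j k / (INR j ^ 2 * INR k ^ 3)
                    - 3 * conn j k / (INR j * INR k ^ 4)
                    + conn' k j / (INR j ^ 2 * INR k ^ 2)
                    - conn j k / (INR j ^ 3 * INR k ^ 2)) +
  rsum 1 N (fun j => rsum 1 j (fun i =>
    (row' N 2 N j - col' N 2 i N) / (INR i * INR j)
    - (row N 2 N j - col N 2 i N) / (INR i * INR j ^ 2))) -
  rsum 1 N (fun i => col' N 3 i N / INR i).
Proof.
  set (F := fun n m => / INR m * row' N 3 n m + - / INR m ^ 2 * row N 3 n m).
  transitivity (rsum 1 N (fun m => F 0%nat m)).
  { unfold F; rewrite (rsum_rows_to_tri N 3 _ _ (fun _ => 0%nat)).
    apply tri_ext; intros j k Hjk; rewrite conn'_0_l, conn_0_l; simpl INR; pfield. }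
  rewrite rsum_to_diagonal.
  unfold F at 1; rewrite (rsum_rows_to_tri N 3 _ _ (fun m => m)).
  rewrite (rsum_ext 1 N _ (fun j =>
    rsum 1 j (fun i => (col' N 3 i (pred j) - col' N 3 i j) / INR i)
    + rsum 1 j (fun i => (row' N 2 N j - col' N 2 i N) / (INR i * INR j)
                - (row N 2 N j - col N 2 i N) / (INR i * INR j ^ 2)))).
  2:{ intros j Hj; rewrite <- rsum_plus; apply rsum_ext; intros i Hi; unfold F.
      transitivity (/ INR j * (row' N 3 (pred i) j - row' N 3 i j)
        + - / INR j ^ 2 * (row N 3 (pred i) j - row N 3 i j)); [ring|].
      rewrite row_step, row'_step, col'_step by lia.
      rewrite (row_col N i j), (row'_col' N i j) by lia; pfield. }
  (* The column tails telescope in the outer index once it is summed first. *)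
  rewrite rsum_plus, rsum_triangle_swap.
  rewrite (rsum_ext 1 N (fun i => rsum i N _) (fun i =>
    / INR i * col' N 3 i (pred i) + (-1) * (col' N 3 i N / INR i))).
  2:{ intros i Hi.
      transitivity (rsum (S (pred i)) N (fun j =>
        / INR i * (col' N 3 i (pred j) - col' N 3 i j))).
      - replace (S (pred i)) with i by lia; apply rsum_ext; intros; pfield.
      - rewrite rsum_scal, (rsum_telescope (pred i) N (fun j => col' N 3 i j)) by lia.
        pfield. }
  rewrite rsum_plus, rsum_scal.
  match goal with |- ?a + (?b + -1 * ?d + ?e) = _ =>
    replace (a + (b + -1 * d + e)) with (a + b + e - d) by ring end.
  f_equal; f_equal.
  rewrite (rsum_ext 1 N _ (fun j => rsum (S j) N (fun k =>
    conn' k j / (INR j * INR k ^ 3) + conn' k j / (INR j ^ 2 * INR k ^ 2)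
    - conn j k / (INR j ^ 3 * INR k ^ 2)))).
  2:{ intros j Hj; unfold col'; rewrite <- rsum_scal; apply rsum_ext; intros k Hk.
      rewrite conn'_step_r, (conn_sym k j) by lia; pfield. }
  rewrite <- (tri_rows N (fun j k => conn' k j / (INR j * INR k ^ 3)
    + conn' k j / (INR j ^ 2 * INR k ^ 2) - conn j k / (INR j ^ 3 * INR k ^ 2))).
  rewrite <- (Rmult_1_l (tri N _)), <- (Rmult_1_l (tri N (fun j k => _ + _ - _))).
  rewrite <- tri_lin; apply tri_ext; intros; simpl INR; pfield.
Qed.

(** * Size of the errors *)

Lemma rsum_double_bound N B (a b : nat -> nat) (f : nat -> nat -> R) : 0 <= B ->
  (forall j, (1 <= j <= N)%nat -> (1 <= a j)%nat /\ (b j <= N)%nat) ->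
  (forall i j, (1 <= j <= N)%nat -> (a j <= i <= b j)%nat ->
     Rabs (f i j) <= B * / INR i * / INR j) ->
  Rabs (rsum 1 N (fun j => rsum (a j) (b j) (fun i => f i j))) <= B * h N * h N.
Proof.
  intros HB Hab Hf.
  assert (Hh := h_nonneg N).
  apply rsum_weight_bound; [lia|lia|nra|]; intros j Hj.
  assert (Hw := inv_le_1 j ltac:(lia)); destruct (Hab j Hj).
  unfold Rdiv; replace (B * h N * / INR j) with (B * / INR j * h N) by ring.
  apply rsum_weight_bound; [easy|easy|nra|]; intros i Hi.
  eapply Rle_trans; [now apply Hf|right; unfold Rdiv; ring].
Qed.

Lemma zeta22_error N : (1 <= N)%nat ->
  Rabs (rsum 1 N (fun j => rsum 1 j (fun i =>
    conn' i N / (INR i ^ 2 * INR j ^ 2) - 2 * conn i N / (INR i ^ 2 * INR j ^ 3))))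
  <= 3 * edge N * h N * h N.
Proof.
  intros HN; assert (HB := edge_nonneg N).
  apply (rsum_double_bound N (3 * edge N) (fun _ => 1%nat) (fun j => j));
    [lra|intros; lia|]; intros i j Hj Hi.
  assert (Hc : Rabs (conn i N) <= edge N) by (rewrite conn_sym; apply conn_edge; lia).
  assert (Hp : Rabs (conn' i N) <= edge N) by (apply conn'_col_edge; lia).
  assert (Hwi := inv_le_1 i ltac:(lia)); assert (Hwj := inv_le_1 j ltac:(lia)).
  replace (conn' i N / (INR i ^ 2 * INR j ^ 2) - 2 * conn i N / (INR i ^ 2 * INR j ^ 3))
    with ((conn' i N - 2 * conn i N * / INR j) * (/ INR i * / INR j) * (/ INR i * / INR j))
    by pfield.
  set (x := / INR i) in *; set (y := / INR j) in *.
  assert (0 < x * y <= 1) by nra.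
  rewrite 2!Rabs_mult, (Rabs_pos_eq (x * y)), (Rmult_assoc (3 * edge N)) by lra.
  assert (Rabs (conn' i N - 2 * conn i N * y) <= 3 * edge N).
  { apply Rabs_le_between in Hc; apply Rabs_le_between in Hp.
    apply Rabs_le_between; split; nra. }
  assert (H1 := Rabs_pos (conn' i N - 2 * conn i N * y)).
  apply Rmult_le_compat_r; nra.
Qed.

Lemma row_col_edge N i j : (1 <= N)%nat ->
  Rabs (row N 2 N j - col N 2 i N) <= 2 * edge N * h N /\
  Rabs (row' N 2 N j - col' N 2 i N) <= 4 * edge N * h N.
Proof.
  intros HN.
  assert (H1 := row_edge N j HN); assert (H2 := col_edge N i HN).
  assert (H3 := row'_edge N j HN); assert (H4 := col'_edge N 2 i HN ltac:(lia)).
  apply Rabs_le_between in H1, H2, H3, H4.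
  split; apply Rabs_le_between; lra.
Qed.

Lemma diagonal_symmetry_error N : (1 <= N)%nat ->
  Rabs (rsum 1 N (fun j => (row' N 2 N j - col' N 2 j N) / INR j ^ 2))
  <= 4 * edge N * h N * h N.
Proof.
  intros HN; assert (HB := edge_nonneg N); assert (Hh := h_nonneg N).
  apply rsum_weight_bound; [lia|lia|nra|]; intros j Hj.
  destruct (row_col_edge N j j HN) as [_ He].
  assert (Hw := inv_le_1 j ltac:(lia)).
  set (e := row' N 2 N j - col' N 2 j N) in *.
  replace (e / INR j ^ 2) with (e * (/ INR j * / INR j)) by pfield.
  rewrite Rabs_mult, (Rabs_pos_eq (_ * _)) by nra.
  assert (H := Rabs_pos e); unfold Rdiv; apply Rmult_le_compat; nra.
Qed.

Lemma zeta31_error N : (1 <= N)%nat ->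
  Rabs (rsum 1 N (fun j => rsum 1 j (fun i =>
    (row' N 2 N j - col' N 2 i N) / (INR i * INR j)
    - (row N 2 N j - col N 2 i N) / (INR i * INR j ^ 2))))
  <= 6 * edge N * h N * h N * h N.
Proof.
  intros HN; assert (HB := edge_nonneg N); assert (Hh := h_nonneg N).
  apply (rsum_double_bound N (6 * edge N * h N) (fun _ => 1%nat) (fun j => j));
    [nra|intros; lia|]; intros i j Hj Hi.
  destruct (row_col_edge N i j HN) as [He He'].
  assert (Hwi := inv_le_1 i ltac:(lia)); assert (Hwj := inv_le_1 j ltac:(lia)).
  set (e := row N 2 N j - col N 2 i N) in *.
  set (e' := row' N 2 N j - col' N 2 i N) in *.
  replace (e' / (INR i * INR j) - e / (INR i * INR j ^ 2))
    with ((e' - e * / INR j) * / INR i * / INR j) by pfield.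
  set (x := / INR i) in *; set (y := / INR j) in *.
  rewrite 2!Rabs_mult, (Rabs_pos_eq x), (Rabs_pos_eq y) by lra.
  apply Rmult_le_compat_r; [lra|]; apply Rmult_le_compat_r; [lra|].
  assert (0 <= edge N * h N) by nra.
  apply Rabs_le_between in He, He'; apply Rabs_le_between; split; nra.
Qed.

Lemma zeta31_col_error N : (1 <= N)%nat ->
  Rabs (rsum 1 N (fun i => col' N 3 i N / INR i)) <= edge N * h N * h N.
Proof.
  intros HN; assert (HB := edge_nonneg N); assert (Hh := h_nonneg N).
  apply rsum_weight_bound; [lia|lia|nra|]; intros i Hi.
  assert (Hw := inv_le_1 i ltac:(lia)).
  unfold Rdiv; rewrite Rabs_mult, (Rabs_pos_eq (/ INR i)) by lra.
  apply Rmult_le_compat_r; [lra|]; apply col'_edge; lia.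
Qed.

(** * Evaluation of the diagonal sum *)

Definition zeta5_upto (N : nat) : R := rsum 1 N (fun k => 1 / INR k ^ 5).
Definition zeta_upto (N a b : nat) : R :=
  tri N (fun j k => 1 / (INR k ^ a * INR j ^ b)).

Lemma harmonic_pred k : (1 <= k)%nat -> h k = h (pred k) + / INR k.
Proof. destruct k as [|k]; [lia|intros _; apply h_S]. Qed.

Lemma zeta41_harmonic N :
  zeta_upto N 4 1 = rsum 1 N (fun k => h (pred k) / INR k ^ 4).
Proof.
  apply rsum_ext; intros k Hk; rewrite h_sum.
  unfold Rdiv at 2; rewrite Rmult_comm, <- rsum_scal.
  apply rsum_ext; intros; pfield.
Qed.

(** The derivative of 4 zeta(4) - 2 zeta(3,1) + zeta(2,2).  The last two enter
    with a factor 2, as the derivatives along the diagonal are twice those in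
    the second index. *)
Lemma axis_combination N :
  4 * rsum 1 N (fun k => - h k / INR k ^ 4 - 4 / INR k ^ 5)
  + 2 * tri N (fun j k => - 2 / (INR j ^ 2 * INR k ^ 3) - 2 / (INR j ^ 3 * INR k ^ 2))
  - 4 * tri N (fun j k => - 3 / (INR j * INR k ^ 4) - 1 / (INR j ^ 2 * INR k ^ 3))
  = - 20 * zeta5_upto N + 8 * zeta_upto N 4 1 - 4 * zeta_upto N 2 3.
Proof.
  rewrite (rsum_ext 1 N _ (fun k =>
    - 1 * (h (pred k) / INR k ^ 4) + - 5 * (1 / INR k ^ 5)))
    by (intros k Hk; rewrite (harmonic_pred k) by lia; pfield).
  rewrite rsum_lin, <- zeta41_harmonic; fold (zeta5_upto N).
  match goal with |- ?x + 2 * ?a - 4 * ?b = _ =>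
    replace (x + 2 * a - 4 * b) with (x + (2 * a + - 4 * b)) by ring end.
  rewrite <- tri_lin.
  rewrite (tri_ext N _ (fun j k => 12 * (1 / (INR k ^ 4 * INR j ^ 1))
    + - 4 * (1 / (INR k ^ 2 * INR j ^ 3)))) by (intros; pfield).
  rewrite tri_lin; fold (zeta_upto N 4 1); fold (zeta_upto N 2 3); ring.
Qed.

(** The derivative of 9 A = 4 zeta(4) - 2 zeta(3,1) + zeta(2,2): in this
    combination the sums over [j < k] that involve the connector cancel. *)
Lemma diagonal_evaluation N : (1 <= N)%nat ->
  Rabs (9 * rsum 1 N (fun k => 2 * conn' k k / INR k ^ 4 - 4 * conn k k / INR k ^ 5)
        - (- 20 * zeta5_upto N + 8 * zeta_upto N 4 1 - 4 * zeta_upto N 2 3))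
  <= 50 * (edge N * h N ^ 3).
Proof.
  intros HN.
  assert (H1 := zeta4_derivative N); assert (H2 := zeta22_derivative N).
  assert (H3 := zeta31_derivative N).
  assert (H4 := diagonal_symmetry N); rewrite <- axis_combination.
  assert (E2 := zeta22_error N HN); assert (E3 := zeta31_error N HN).
  assert (E3' := zeta31_col_error N HN); assert (E4 := diagonal_symmetry_error N HN).
  set (L1 := rsum 1 N (fun k => - h k / _ - _)) in *.
  set (L2 := tri N (fun j k => - 2 / _ - _)) in *.
  set (L3 := tri N (fun j k => - 3 / _ - _)) in *.
  set (T1 := tri N (fun j k => (conn' j k + conn' k j) / _ - _ - conn j k / (INR j ^ 2 * INR k ^ 3))) in *.
  set (T2 := tri N (fun j k => 2 * conn' j k / _ - _ - _)) in *.
  set (T3 := tri N (fun j k => _ - _ - _ + _ - _)) in *.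
  set (T4 := tri N (fun j k => (conn' j k - conn' k j) / _ - _)) in *.
  set (e2 := rsum 1 N _) in E2; set (e3 := rsum 1 N _) in E3.
  set (e3' := rsum 1 N _) in E3'; set (e4 := rsum 1 N _) in E4.
  fold e2 in H2; fold e3 e3' in H3; fold e4 in H4.
  (* T4 trades the derivative in one argument for that in the other. *)
  assert (HT : 4 * T1 + -4 * T3 + 2 * T2 + -4 * T4 = 0).
  { unfold T1, T2, T3, T4.
    transitivity (1 * (4 * T1 + -4 * T3) + 1 * (2 * T2 + -4 * T4)).
    - unfold T1, T2, T3, T4; ring.
    - unfold T1, T2, T3, T4; rewrite <- 3!tri_lin.
      rewrite (tri_ext N _ (fun _ _ => 0 * 0 + 0 * 0)) by (intros; pfield).
      rewrite tri_lin; ring. }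
  set (D1 := rsum 1 N (fun k => 4 * conn' k k / _ - _)) in *.
  set (D2 := rsum 1 N (fun k => conn' k k / _ - _)) in *.
  assert (HD : 9 * rsum 1 N (fun k => 2 * conn' k k / INR k ^ 4 - 4 * conn k k / INR k ^ 5)
               = 4 * D1 + 2 * D2).
  { unfold D1, D2; rewrite <- rsum_scal, <- rsum_lin.
    apply rsum_ext; intros; pfield. }
  rewrite HD.
  replace (4 * D1 + 2 * D2 - (4 * L1 + 2 * L2 - 4 * L3))
    with (2 * e2 + 4 * e3 - 4 * e3' - 4 * e4) by lra.
  assert (Hb := edge_nonneg N); assert (Hh := h_ge_1 N HN).
  assert (Hbh : edge N * h N * h N <= edge N * h N ^ 3).
  { simpl; assert (0 <= edge N * h N * h N) by (apply Rmult_le_pos; nra). nra. }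
  apply Rabs_le_between in E2, E3, E3', E4; apply Rabs_le_between.
  simpl in *; lra.
Qed.

(** * Relations between double zeta values of weight five *)

Lemma tri_reflect N f : tri N (fun j k => f (k - j)%nat k) = tri N f.
Proof.
  apply rsum_ext; intros k Hk.
  rewrite <- (rsum_reflect (pred k) (fun j => f j k)).
  apply rsum_ext; intros; f_equal; lia.
Qed.

Lemma rsum_square N (f : nat -> nat -> R) :
  rsum 1 N (fun a => rsum 1 N (fun b => f a b)) =
  tri N f + tri N (fun j k => f k j) + rsum 1 N (fun k => f k k).
Proof.
  rewrite Rplus_assoc, <- (rsum_triangle N (fun j k => f k j)).
  rewrite tri_rows, Rplus_comm, <- rsum_plus.
  apply rsum_ext; intros a Ha; apply rsum_split; lia.
Qed.

Lemma rsum_square_antidiagonals N (f : nat -> nat -> R) :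
  rsum 1 N (fun a => rsum 1 N (fun b => f a b)) =
  tri N (fun j k => f j (k - j)%nat)
  + rsum 1 N (fun a => rsum (S (N - a)) N (fun b => f a b)).
Proof.
  rewrite tri_rows, <- rsum_plus; apply rsum_ext; intros a Ha.
  rewrite (rsum_split 1 (N - a) N) by lia; f_equal.
  replace (S a) with (1 + a)%nat by lia.
  replace N with (N - a + a)%nat at 2 by lia.
  rewrite rsum_shift; apply rsum_ext; intros; f_equal; lia.
Qed.

(** Each of the [j] terms [1 / (N - i)], with [i < j], is at most [(i + 1) / N], because
    [N <= (N - i) (i + 1)]. *)
Lemma harmonic_gap N j : (j <= N)%nat -> (1 <= N)%nat ->
  0 <= h N - h (N - j) <= INR j ^ 2 / INR N.
Proof.
  intros Hj HN; split.
  { assert (H := h_mono (N - j) N ltac:(lia)); lra. }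
  assert (HNp := INR_index_pos N HN).
  induction j as [|j IH].
  - rewrite Nat.sub_0_r; simpl; unfold Rdiv; lra.
  - assert (H := harmonic_pred (N - j) ltac:(lia)).
    replace (pred (N - j)) with (N - S j)%nat in H by lia.
    assert (H1 : / INR (N - j) <= INR (S j) / INR N).
    { assert (H2 := INR_index_pos (N - j) ltac:(lia)).
      apply Rmult_le_reg_l with (INR (N - j)); [easy|].
      rewrite Rinv_r by lra.
      apply Rmult_le_reg_r with (INR N); [easy|].
      replace (INR (N - j) * (INR (S j) / INR N) * INR N) with (INR (N - j) * INR (S j))
        by (field; lra).
      rewrite Rmult_1_l, <- mult_INR; apply le_INR; nia. }
    specialize (IH ltac:(lia)).
    apply Rle_trans with (INR j ^ 2 / INR N + INR (S j) / INR N); [lra|].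
    unfold Rdiv; rewrite <- Rmult_plus_distr_r; apply Rmult_le_compat_r.
    + left; now apply Rinv_0_lt_compat.
    + rewrite S_INR; assert (H2 := pos_INR j); simpl; nra.
Qed.

(** Euler's sum formula zeta(4,1) + zeta(3,2) + zeta(2,3) = zeta(5).  The three
    terms form a geometric progression, whose sum is
    [1 / (j^3 k (k - j)) - 1 / (k^4 (k - j))]; the first part telescopes in [k], the
    second is a harmonic number by reflection. *)
Lemma sum_formula N : (1 <= N)%nat ->
  Rabs (zeta_upto N 4 1 + zeta_upto N 3 2 + zeta_upto N 2 3 - zeta5_upto N)
  <= / INR N * h N.
Proof.
  intros HN.
  assert (E : zeta_upto N 4 1 + zeta_upto N 3 2 + zeta_upto N 2 3 - zeta5_upto N
     = - rsum 1 N (fun j => (h N - h (N - j)) / INR j ^ 4)).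
  2:{ rewrite E, Rabs_Ropp.
      assert (H0 := inv_le_1 N HN).
      apply rsum_weight_bound; [lia|lia|lra|]; intros j Hj.
      assert (Hg := harmonic_gap N j ltac:(lia) HN).
      assert (Hw := inv_le_1 j ltac:(lia)).
      assert (Hj0 := INR_index_pos j ltac:(lia)).
      assert (H4 := pow_lt _ 4 Hj0).
      rewrite Rabs_pos_eq by (apply Rmult_le_pos; [lra|left; now apply Rinv_0_lt_compat]).
      apply Rle_trans with (INR j ^ 2 / INR N / INR j ^ 4).
      - apply Rmult_le_compat_r; [left; now apply Rinv_0_lt_compat|lra].
      - replace (INR j ^ 2 / INR N / INR j ^ 4) with (/ INR N * / INR j * / INR j) by pfield.
        unfold Rdiv; rewrite Rmult_assoc; apply Rmult_le_compat_l; nra. }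
  assert (T : zeta_upto N 4 1 + zeta_upto N 3 2 + zeta_upto N 2 3
    = tri N (fun j k => 1 / (INR j ^ 3 * INR k * INR (k - j)))
      - tri N (fun j k => / INR (k - j) / INR k ^ 4)).
  { unfold zeta_upto.
    transitivity (1 * (1 * tri N (fun j k => 1 / (INR k ^ 4 * INR j ^ 1))
      + 1 * tri N (fun j k => 1 / (INR k ^ 3 * INR j ^ 2)))
      + 1 * tri N (fun j k => 1 / (INR k ^ 2 * INR j ^ 3))); [ring|].
    match goal with |- _ = ?a - ?b => transitivity (1 * a + -1 * b); [|ring] end.
    rewrite <- 3!tri_lin; apply tri_ext; intros j k Hjk.
    assert (H0 : INR k - INR j <> 0).
    { assert (INR j < INR k) by (apply lt_INR; lia); lra. }
    rewrite minus_INR by lia; field; repeat split; try easy; apply not_0_INR; lia. }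
  rewrite T.
  rewrite (tri_reflect N (fun j k => / INR j / INR k ^ 4)).
  replace (tri N (fun j k => / INR j / INR k ^ 4)) with (zeta_upto N 4 1)
    by (apply tri_ext; intros; pfield).
  rewrite zeta41_harmonic, tri_rows; unfold zeta5_upto.
  rewrite (rsum_ext 1 N _ (fun j => (h (N - j) - (h N - h j)) / INR j ^ 4)).
  { rewrite <- 2!rsum_minus.
    match goal with |- _ = - ?x => replace (- x) with (-1 * x) by ring end.
    rewrite <- rsum_scal; apply rsum_ext; intros j Hj.
    rewrite (harmonic_pred j) by lia; pfield. }
  intros j Hj.
  transitivity (/ INR j ^ 4 * rsum (S j) N (fun k => / INR (k - j) - / INR k)).
  { rewrite <- rsum_scal; apply rsum_ext; intros k Hk.
    assert (H0 : INR k - INR j <> 0).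
    { assert (INR j < INR k) by (apply lt_INR; lia); lra. }
    rewrite minus_INR by lia; field; repeat split; try easy; apply not_0_INR; lia. }
  rewrite rsum_minus; unfold Rdiv; rewrite Rmult_comm; f_equal; f_equal.
  - rewrite h_sum; replace (S j) with (1 + j)%nat by lia.
    replace N with (N - j + j)%nat at 1 by lia.
    rewrite rsum_shift; apply rsum_ext; intros; do 2 f_equal; lia.
  - rewrite 2!h_sum, (rsum_split 1 j N) by lia; ring.
Qed.

(** Two evaluations of zeta(2) zeta(3): comparing the two indices gives
    zeta(3,2) + zeta(2,3) + zeta(5), and partial fractions in the sum of the
    indices give 3 zeta(3,2) + 6 zeta(4,1) + zeta(2,3). *)
Lemma double_shuffle N : (1 <= N)%nat ->
  Rabs (6 * zeta_upto N 4 1 + 2 * zeta_upto N 3 2 - zeta5_upto N)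
  <= / INR N * h N * h N.
Proof.
  intros HN.
  set (f := fun a b : nat => 1 / (INR a ^ 2 * INR b ^ 3)).
  assert (H := rsum_square_antidiagonals N f); rewrite rsum_square in H.
  (* The pairs of the square that lie beyond the antidiagonal [a + b = N]. *)
  set (r := rsum 1 N (fun a => rsum _ _ _)) in H.
  assert (Hr : Rabs r <= / INR N * h N * h N).
  { assert (H0 := inv_le_1 N HN).
    apply (rsum_double_bound N (/ INR N) (fun a => S (N - a)) (fun _ => N) (fun b a => f a b));
      [lra|intros; lia|]; intros b a Ha Hb; unfold f.
    assert (Hwa := inv_le_1 a ltac:(lia)); assert (Hwb := inv_le_1 b ltac:(lia)).
    replace (1 / (INR a ^ 2 * INR b ^ 3))
      with (/ (INR a * INR b) * / INR b * (/ INR b * / INR a)) by pfield.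
    (* Here [a + b > N], whence [a b >= a + b - 1 >= N]. *)
    assert (Hab : 0 < / (INR a * INR b) <= / INR N).
    { rewrite <- mult_INR; split.
      - apply Rinv_0_lt_compat, INR_index_pos; nia.
      - apply Rinv_le_contravar; [now apply INR_index_pos|apply le_INR; nia]. }
    set (x := / INR b) in *; set (y := / INR a) in *; set (z := / (INR a * INR b)) in *.
    rewrite Rabs_pos_eq by (repeat apply Rmult_le_pos; lra).
    rewrite (Rmult_assoc (/ INR N)); apply Rmult_le_compat_r; nra. }
  assert (T : tri N (fun j k => f j (k - j)%nat) =
     3 * zeta_upto N 3 2 + 6 * zeta_upto N 4 1 + zeta_upto N 2 3).
  { set (u := fun j k => 1 / (INR k ^ 2 * INR j ^ 3) + 2 / (INR k ^ 3 * INR j ^ 2)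
                          + 3 / (INR k ^ 4 * INR j)).
    transitivity (tri N (fun j k => 1 * (1 / (INR k ^ 3 * INR j ^ 2) + 3 / (INR k ^ 4 * INR j))
      + 1 * u (k - j)%nat k)).
    { apply tri_ext; intros j k Hjk; unfold f, u.
      assert (H0 : INR k - INR j <> 0).
      { assert (INR j < INR k) by (apply lt_INR; lia); lra. }
      rewrite minus_INR by lia; field; repeat split; try easy; apply not_0_INR; lia. }
    rewrite tri_lin, (tri_reflect N u), <- tri_lin; unfold zeta_upto, u.
    transitivity (1 * (3 * tri N (fun j k => 1 / (INR k ^ 3 * INR j ^ 2))
      + 6 * tri N (fun j k => 1 / (INR k ^ 4 * INR j ^ 1)))
      + 1 * tri N (fun j k => 1 / (INR k ^ 2 * INR j ^ 3))); [|ring].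
    rewrite <- 2!tri_lin; apply tri_ext; intros; pfield. }
  rewrite T in H.
  replace (tri N f) with (zeta_upto N 3 2) in H
    by (apply tri_ext; intros; unfold f; pfield).
  replace (tri N (fun j k => f k j)) with (zeta_upto N 2 3) in H
    by (apply tri_ext; intros; unfold f; pfield).
  replace (rsum 1 N (fun k => f k k)) with (zeta5_upto N) in H
    by (apply rsum_ext; intros; unfold f; pfield).
  replace (6 * zeta_upto N 4 1 + 2 * zeta_upto N 3 2 - zeta5_upto N) with (- r) by lra.
  now rewrite Rabs_Ropp.
Qed.

(** Twice [sum_formula] minus [double_shuffle]. *)
Lemma zeta_relation N : (1 <= N)%nat ->
  Rabs (2 * zeta_upto N 2 3 - 4 * zeta_upto N 4 1 - zeta5_upto N)
  <= 6 * (edge N * h N ^ 3).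
Proof.
  intros HN.
  assert (H1 := sum_formula N HN); assert (H2 := double_shuffle N HN).
  assert (Hh := h_ge_1 N HN); assert (HNp := INR_index_pos N HN).
  assert (H0 : / INR N * h N <= 2 * edge N).
  { unfold edge, Rdiv; rewrite S_INR.
    assert (H1N : 1 <= INR N) by (rewrite <- INR_1; now apply le_INR).
    replace (2 * (h N * / (INR N + 1))) with (2 * / (INR N + 1) * h N) by ring.
    apply Rmult_le_compat_r; [lra|].
    apply Rmult_le_reg_l with (INR N * (INR N + 1)); [nra|].
    replace (INR N * (INR N + 1) * / INR N) with (INR N + 1) by (field; lra).
    replace (INR N * (INR N + 1) * (2 * / (INR N + 1))) with (2 * INR N) by (field; lra).
    lra. }
  assert (Hb := edge_nonneg N).
  assert (Hb1 : edge N <= edge N * h N) by nra.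
  assert (Hb2 : edge N * h N <= edge N * h N ^ 3) by (simpl; nra).
  assert (H3 : / INR N * h N * h N <= 2 * edge N * h N) by (apply Rmult_le_compat_r; lra).
  apply Rabs_le_between in H1, H2; apply Rabs_le_between; lra.
Qed.

(** * Passage to the limit *)

(** The summand is, up to the factor -2, the derivative at [a = 0] of
    [conn (k + a) (k + a) / (k + a)^4]. *)
Lemma summand_diagonal k : (1 <= k)%nat ->
  2 * conn' k k / INR k ^ 4 - 4 * conn k k / INR k ^ 5 = -2 * summand k.
Proof.
  intros Hk; unfold summand, Binomial.C, conn'; fold (h (2 * k)) (h k).
  replace (2 * k - k)%nat with k by lia.
  replace (k + k)%nat with (2 * k)%nat by lia.
  assert (Hc : conn k k = INR (fact k) * INR (fact k) / INR (fact (2 * k)))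
    by (unfold conn; do 3 f_equal; lia).
  rewrite Hc; field; repeat split; try apply INR_fact_neq_0; apply not_0_INR; lia.
Qed.

Lemma partial_sum_estimate N : (1 <= N)%nat ->
  Rabs (18 * rsum 1 N summand - 22 * zeta5_upto N) <= 62 * (h N ^ 4 / INR (S N)).
Proof.
  intros HN.
  assert (H1 := diagonal_evaluation N HN); assert (H2 := zeta_relation N HN).
  replace (rsum 1 N (fun k => 2 * conn' k k / INR k ^ 4 - 4 * conn k k / INR k ^ 5))
    with (-2 * rsum 1 N summand) in H1
    by (rewrite <- rsum_scal; apply rsum_ext; intros; now rewrite summand_diagonal).
  replace (h N ^ 4 / INR (S N)) with (edge N * h N ^ 3) by (unfold edge, Rdiv; ring).
  apply Rabs_le_between in H1, H2; apply Rabs_le_between; lra.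
Qed.

(** From [exp (1 / (n + 1)) <= (n + 1) / n], the product telescopes. *)
Lemma exp_harmonic N : exp (h N) <= 3 * INR (S N).
Proof.
  assert (H : forall n, exp (h (S n) - 1) <= INR (S n)).
  { induction n as [|n IH].
    - rewrite h_S, h_0; simpl; replace (0 + / 1 - 1) with 0 by field; rewrite exp_0; lra.
    - rewrite h_S; set (x := / INR (S (S n))).
      replace (h (S n) + x - 1) with ((h (S n) - 1) + x) by ring.
      rewrite exp_plus.
      assert (Hn := INR_index_pos (S n) ltac:(lia)).
      assert (Hx : exp x <= INR (S (S n)) / INR (S n)).
      { assert (H1 := exp_ineq1_le (- x)).
        assert (H2 : 1 + - x = INR (S n) / INR (S (S n))).
        { unfold x; rewrite (S_INR (S n)); field; lra. }
        rewrite H2 in H1; rewrite <- (Ropp_involutive x), (exp_Ropp (- x)).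
        replace (INR (S (S n)) / INR (S n)) with (/ (INR (S n) / INR (S (S n)))).
        - apply Rinv_le_contravar; [|easy].
          apply Rdiv_lt_0_compat; apply INR_index_pos; lia.
        - field; split; apply not_0_INR; lia. }
      apply Rle_trans with (INR (S n) * (INR (S (S n)) / INR (S n))).
      + apply Rmult_le_compat; try easy; left; apply exp_pos.
      + right; field; lra. }
  apply Rle_trans with (exp (1 + (h (S N) - 1))).
  - assert (H1 := h_mono N (S N) ltac:(lia)).
    destruct (Rle_lt_or_eq_dec (h N) (1 + (h (S N) - 1)) ltac:(lra)) as [H2|H2].
    + left; now apply exp_increasing.
    + rewrite <- H2; lra.
  - rewrite exp_plus; apply Rmult_le_compat; try (left; apply exp_pos).
    + exact exp_le_3.
    + apply H.
Qed.

(** With [exp x >= x], the eighth power of [h N / 8] is at most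
    [exp (h N)], hence linear in [N]. *)
Lemma harmonic_pow_small N : h N ^ 4 / INR (S N) <= 12288 / sqrt (INR (S N)).
Proof.
  assert (HN := INR_index_pos (S N) ltac:(lia)); assert (Hh := h_nonneg N).
  assert (Hs := sqrt_lt_R0 _ HN); assert (Hss := sqrt_sqrt _ (Rlt_le _ _ HN)).
  set (s := sqrt (INR (S N))) in *.
  set (y := exp (h N / 8)).
  assert (Hy : h N / 8 <= y) by (assert (H := exp_ineq1_le (h N / 8)); unfold y; lra).
  assert (Hy8 : (y ^ 4) ^ 2 <= 3 * (s * s)).
  { rewrite Hss; eapply Rle_trans; [right|apply exp_harmonic].
    unfold y; replace (h N) with (h N / 8 + h N / 8 + h N / 8 + h N / 8 + h N / 8
      + h N / 8 + h N / 8 + h N / 8) at 2 by field.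
    rewrite !exp_plus; ring. }
  assert (Hy4 : h N ^ 4 <= 4096 * y ^ 4).
  { replace (h N ^ 4) with (4096 * (h N / 8) ^ 4) by field.
    apply Rmult_le_compat_l; [lra|]; apply pow_incr; lra. }
  assert (Hy4s : y ^ 4 <= 3 * s).
  { assert (0 <= y ^ 4) by (apply pow_le; lra). nra. }
  rewrite <- Hss; apply Rle_trans with (4096 * (3 * s) / (s * s)).
  - apply Rmult_le_compat_r; [left; apply Rinv_0_lt_compat; nra|lra].
  - right; field; lra.
Qed.

Lemma inv_sqrt_lim : is_lim_seq (fun n => / sqrt (INR (S n))) 0.
Proof.
  replace (Finite 0) with (Rbar_inv p_infty) by reflexivity.
  apply is_lim_seq_inv; [|discriminate].
  apply filterlim_comp with (2 := filterlim_sqrt_p).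
  change (is_lim_seq (fun n => INR (S n)) p_infty).
  apply (is_lim_seq_incr_1 INR), is_lim_seq_INR.
Qed.

Lemma sum_n_rsum (f : nat -> R) n : sum_n (fun i => f (S i)) n = rsum 1 (S n) f.
Proof.
  induction n as [|n IH].
  - rewrite sum_O, rsum_last, rsum_empty by lia; symmetry; apply Rplus_0_l.
  - now rewrite sum_Sn, IH, (rsum_last 1 (S n)) by lia.
Qed.

Lemma zeta5_upto_lim : is_lim_seq (fun n => zeta5_upto (S n)) zeta5.
Proof.
  assert (Hs : forall n, sum_n (fun i => 1 / INR (S i) ^ 5) n = zeta5_upto (S n)).
  { exact (sum_n_rsum (fun k => 1 / INR k ^ 5)). }
  assert (Hb : forall n, zeta5_upto (S n) <= 2 - / INR (S n)).
  { induction n as [|n IH]; unfold zeta5_upto in *.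
    - rewrite rsum_last, rsum_empty by lia; simpl; lra.
    - rewrite rsum_last by lia.
      enough (1 / INR (S (S n)) ^ 5 <= / INR (S n) - / INR (S (S n))) by lra.
      assert (H1 := INR_index_pos (S n) ltac:(lia)).
      rewrite (S_INR (S n)); set (x := INR (S n)) in *.
      replace (/ x - / (x + 1)) with (/ (x * (x + 1))) by (field; lra).
      unfold Rdiv; rewrite Rmult_1_l; apply Rinv_le_contravar; [nra|].
      replace ((x + 1) ^ 5) with ((x + 1) ^ 2 * (x + 1) ^ 3) by ring.
      assert (1 <= (x + 1) ^ 3) by (apply pow_R1_Rle; lra).
      simpl in *; nra. }
  assert (Hex : ex_series (fun i => 1 / INR (S i) ^ 5)).
  { destruct (ex_finite_lim_seq_incr (sum_n (fun i => 1 / INR (S i) ^ 5)) 2) as [l Hl].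
    - intros n; rewrite sum_Sn; change plus with Rplus.
      assert (0 < 1 / INR (S (S n)) ^ 5); [|lra].
      apply Rdiv_lt_0_compat; [lra|]; apply pow_lt, INR_index_pos; lia.
    - intros n; rewrite Hs; specialize (Hb n).
      assert (H := inv_le_1 (S n) ltac:(lia)); lra.
    - now exists l. }
  apply is_lim_seq_ext with (1 := Hs).
  exact (Series_correct _ Hex).
Qed.

Theorem mainTheorem16 :
  is_series (fun k : nat => summand (S k)) (11 / 9 * zeta5).
Proof.
  change (is_lim_seq (sum_n (fun k : nat => summand (S k))) (11 / 9 * zeta5)).
  apply is_lim_seq_ext with (fun n => rsum 1 (S n) summand).
  { intros n; symmetry; apply sum_n_rsum. }
  (* By the two estimates the error is at most 62 * 12288 / 18 over the root. *)
  set (e := fun n => 43008 * / sqrt (INR (S (S n)))).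
  assert (He : is_lim_seq e 0).
  { replace (Finite 0) with (Rbar_mult 43008 0) by (simpl; f_equal; ring).
    apply is_lim_seq_scal_l.
    apply (is_lim_seq_incr_1 (fun n => / sqrt (INR (S n)))), inv_sqrt_lim. }
  assert (Hz : is_lim_seq (fun n => 11 / 9 * zeta5_upto (S n)) (11 / 9 * zeta5))
    by exact (is_lim_seq_scal_l _ (11 / 9) _ zeta5_upto_lim).
  apply is_lim_seq_le_le with (fun n => 11 / 9 * zeta5_upto (S n) - e n)
                              (fun n => 11 / 9 * zeta5_upto (S n) + e n).
  - intros n.
    assert (H1 := partial_sum_estimate (S n) ltac:(lia)).
    assert (H2 := harmonic_pow_small (S n)).
    apply Rabs_le_between in H1; unfold e; unfold Rdiv at 2 in H2; lra.
  - replace (11 / 9 * zeta5) with (11 / 9 * zeta5 - 0) by ring.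
    now apply is_lim_seq_minus'.
  - replace (11 / 9 * zeta5) with (11 / 9 * zeta5 + 0) by ring.
    now apply is_lim_seq_plus'.
Qed.
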